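(* Let $\varepsilon > 0$ be any small constant. Then any algorithm in the sliding window model that computes a $(2-\varepsilon)$-approximate solution to \textsf{Interval Selection} on unit-length intervals with probability at least $2/3$ requires a memory of size $\Omega(L)$, where $L$ is the sliding window size.
   Context: In the sliding window model, an algorithm (possibly randomized) receives a stream of intervals on the real line, and at every moment must be able to output a solution for the current sliding window, which consists of the $L$ most recent intervals of the stream. In \textsf{Interval Selection}, the goal is to output a subset of pairwise disjoint intervals of the current window of maximum cardinality. A $(2-\varepsilon)$-approximate solution is a set of pairwise disjoint intervals from the current window of size at least $|OPT|/(2-\varepsilon)$, where $OPT$ is a maximum set of pairwise disjoint intervals in the current window. Unit-length means every interval has the form $[r,r+1]$ for a real $r$. $L$ is assumed to be larger than a suitable constant. *)

(* Defs.v *)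
From HB Require Import structures.
From mathcomp Require Import all_boot all_order all_algebra.
From mathcomp Require Import finmap.
From mathcomp Require Import all_classical all_reals all_analysis.

Set Implicit Arguments.
Unset Strict Implicit.
Unset Printing Implicit Defensive.

Import Order.TTheory GRing.Theory Num.Theory.

Local Open Scope classical_set_scope.
Local Open Scope ring_scope.

Section IntervalSelection.
Variable R : realType.

(* A unit-length interval is encoded by its left endpoint. *)
Definition unit_itv (r : R) : set R := `[r, r + 1]%classic.

Definition window (L : nat) (s : seq R) : seq R := drop (size s - L) s.

(* Two copies of one interval intersect, so a solution never repeats an
   interval and a finite set of left endpoints loses nothing. *)
Definition is_solution (w : seq R) (A : {fset R}) : Prop :=
  {subset A <= w} /\ trivIset [set` A] unit_itv.

Definition is_max_solution (w : seq R) (A : {fset R}) : Prop :=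
  is_solution w A /\
  forall B : {fset R}, is_solution w B -> (#|` B| <= #|` A|)%N.

Definition is_approx_solution (rho : R) (w : seq R) (A : {fset R}) : Prop :=
  is_solution w A /\
  exists2 OPT : {fset R}, is_max_solution w OPT &
    #|` OPT|%:R / rho <= #|` A|%:R.

(* A streaming algorithm with m bits of memory and randomness in T. Only the
   m-bit memory is charged for: the random source, the clock (the nat argument,
   the number of intervals read so far) and the computation are free. Taking T
   to be a space of coin sequences indexed by time, this covers fresh coins at
   every step as well as a random string that can be read again and again. *)
Record algorithm (T : Type) (m : nat) := Algorithm {
  init : T -> m.-tuple bool ;
  update : nat -> T -> m.-tuple bool -> R -> m.-tuple bool ;
  output : nat -> T -> m.-tuple bool -> {fset R} }.

Fixpoint run_from (T : Type) (m : nat) (A : algorithm T m) (t : nat) (x : T)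
    (M : m.-tuple bool) (s : seq R) : {fset R} :=
  if s is r :: s' then run_from A t.+1 x (update A t x M r) s'
  else output A t x M.

Definition run (T : Type) (m : nat) (A : algorithm T m) (s : seq R) (x : T) :
    {fset R} :=
  run_from A 0 x (init A x) s.

(* s ranges over all finite prefixes of streams, i.e. over all moments. The
   success probability is required at each moment separately, which is weaker
   than requiring success at all moments simultaneously. *)
Definition computes_approx (U : set R) (L : nat) (rho p : R)
    (d : measure_display) (T : measurableType d) (P : probability T R)
    (m : nat) (A : algorithm T m) : Prop :=
  forall s : seq R, (forall r, r \in s -> U r) ->
    let success := [set x | is_approx_solution rho (window L s) (run A s x)] in
    measurable success /\ (p%:E <= P success)%E.

(* The left endpoints in [0, 2] that are multiples of 1 / N. Quantifying the
   streams over a set U of left endpoints that contains fixed_precision N covers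
   U = setT, i.e. arbitrary real intervals, but also finite U. The latter
   matter: an algorithm with finitely many memory states cannot reproduce
   infinitely many distinct intervals, whatever its memory size. *)
Definition fixed_precision (N : nat) : set R :=
  [set k%:R / N%:R | k in [set k : nat | (k <= 2 * N)%N]].

End IntervalSelection.

Arguments fixed_precision R N : clear implicits.

(* Main.v *)
(** Reduction from the one-way communication problem INDEX. A string x of n bits
    is streamed as the intervals with left endpoints (2 j + x_j) / N, which all
    meet each other. To ask for bit i, copies of the interval with left endpoint
    1 + (2 i + 2) / N are appended until interval i is the oldest one in the
    window. It is then the only one disjoint from the query, so OPT = 2, every
    (2 - eps)-approximate solution contains interval i, and the memory content
    after the first n intervals determines each bit with probability 2/3.
    Averaging fixes the randomness and gives maps enc and dec through m bits with
    2n/3 correct bits on average. For each fixed y, the sum over x of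
    2 ^ #{i | x_i = y_i} is 3 ^ n; summing over the 2 ^ m decoded strings and
    using convexity of 2 ^ k yields 2 ^ (2n/3) * 2 ^ n <= 2 ^ m * 3 ^ n. *)
Require Import Defs.
From HB Require Import structures.
From mathcomp Require Import all_boot all_order all_algebra.
From mathcomp Require Import finmap.
From mathcomp Require Import all_classical all_reals all_analysis.
From mathcomp Require Import measurable_realfun zify lra.

Set Implicit Arguments.
Unset Strict Implicit.
Unset Printing Implicit Defensive.

Import Order.TTheory GRing.Theory Num.Theory.

Local Open Scope classical_set_scope.
Local Open Scope ring_scope.

(** * Counting bound for codes that recover two thirds of the bits *)

Definition agreement (n : nat) (x y : {ffun 'I_n -> bool}) : nat :=
  (\sum_i (x i == y i))%N.

Lemma sum_exp2_agreement (n : nat) (y : {ffun 'I_n -> bool}) :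
  (\sum_x 2 ^ agreement x y = 3 ^ n)%N.
Proof.
transitivity (\sum_x \prod_i 2 ^ ((x : {ffun 'I_n -> bool}) i == y i))%N.
  by apply: eq_bigr => x _; rewrite expn_sum.
rewrite -(bigA_distr_bigA (fun i b => 2 ^ (b == y i)))%N.
under eq_bigr do rewrite big_bool /=.
transitivity (\prod_(i < n) 3)%N; last by rewrite prod_nat_const card_ord.
by apply: eq_bigr => i _; case: (y i).
Qed.

(** Since [enc x] is one of the [#|M|] messages, each term is at most the sum over all messages,
    where [dec y] no longer depends on [x]. *)
Lemma sum_exp2_agreement_code (n : nat) (M : finType)
    (enc : {ffun 'I_n -> bool} -> M) (dec : M -> {ffun 'I_n -> bool}) :
  (\sum_x 2 ^ agreement x (dec (enc x)) <= #|M| * 3 ^ n)%N.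
Proof.
apply: (@leq_trans (\sum_x \sum_y 2 ^ agreement x (dec y))%N).
  by apply: leq_sum => x _; rewrite (bigD1 (enc x)) //= leq_addr.
rewrite exchange_big /= -sum_nat_const.
by apply: leq_sum => y _; rewrite sum_exp2_agreement.
Qed.

(* The tangent line of 2 ^ k at k0, with slope rounded up from ln 2 to 1 since
   only integer exponents matter. *)
Lemma exp2_tangent (k0 k : nat) : (2 ^ k0 * k.+1 <= 2 ^ k + 2 ^ k0 * k0)%N.
Proof.
have [le_k|lt_k] := leqP k0 k; last by nia.
have -> : k = (k0 + (k - k0))%N by lia.
move: (k - k0)%N => j; rewrite expnD -mulnDr leq_mul2l; apply/orP; right.
by have := ltn_expl j (ltnSn 1); lia.
Qed.

Lemma code_size (q m : nat)
    (enc : {ffun 'I_(3 * q) -> bool} -> m.-tuple bool)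
    (dec : m.-tuple bool -> {ffun 'I_(3 * q) -> bool}) :
  (2 * q * 2 ^ (3 * q) <= \sum_x agreement x (dec (enc x)))%N ->
  (q <= 5 * m)%N.
Proof.
move=> good.
have := sum_exp2_agreement_code enc dec.
rewrite card_tuple card_bool => ub.
have lb : (2 ^ (2 * q) * 2 ^ (3 * q) <=
    \sum_x 2 ^ agreement x (dec (enc x)))%N.
  (* Jensen by tangents at [2 * q]: by [good] the average agreement is at least [2 * q], so the
     linear terms cancel. *)
  have : (\sum_x 2 ^ (2 * q) * (agreement x (dec (enc x))).+1 <=
      \sum_x (2 ^ agreement x (dec (enc x)) + 2 ^ (2 * q) * (2 * q)))%N.
    by apply: leq_sum => x _; exact: exp2_tangent.
  rewrite big_split /= sum_nat_const card_ffun card_bool card_ord.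
  rewrite -big_distrr /=; under eq_bigr do rewrite -addn1.
  rewrite big_split /= sum_nat_const card_ffun card_bool card_ord muln1.
  have := leq_mul (leqnn (2 ^ (2 * q))) good.
  move: (2 ^ (2 * q))%N (2 ^ (3 * q))%N (\sum_x agreement _ _)%N
    (\sum_x 2 ^ agreement _ _)%N => u v a b.
  by nia.
have := leq_trans lb ub; rewrite -expnD => le_code.
(* From [3 ^ 5 = 243 <= 256 = 2 ^ 8]; comparing fifth powers then gives [25 q <= 5 m + 24 q]. *)
have le3 : (3 ^ (3 * q * 5) <= 2 ^ (8 * (3 * q)))%N.
  rewrite mulnC (expnM 3) (expnM 2).
  by case: (3 * q)%N => // k; rewrite leq_exp2r.
have : (2 ^ ((2 * q + 3 * q) * 5) <= 2 ^ (m * 5 + 8 * (3 * q)))%N.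
  rewrite expnD; apply: leq_trans (leq_mul (leqnn _) le3).
  by rewrite !(expnM _ _ 5) -expnMn leq_exp2r.
by rewrite leq_exp2l //; lia.
Qed.

(** * Fixing the randomness *)

(** The number of events that occur has expectation at least [p * #|I|], and its maximum is attained
    because it takes finitely many values. *)
Lemma exists_outcome_many_events (R : realType) (d : measure_display)
    (T : measurableType d) (P : probability T R) (I : finType)
    (S : I -> set T) (p : R) :
  (forall i, measurable (S i)) -> (forall i, (p%:E <= P (S i))%E) ->
  exists t, p * #|I|%:R <= #|[set i | `[< S i t >]]%SET|%:R.
Proof.
move=> mS pS; pose f t := #|[set i | `[< S i t >]]%SET|.
have [t0 _] : [set: T] !=set0.
  apply/set0P/eqP => T0; have := probability_setT P.
  by rewrite T0 measure0 => /esym/eqP; rewrite eqe oner_eq0.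
have exf : exists k, `[< exists t, f t = k >].
  by exists (f t0); apply/asboolP; exists t0.
have ubf k : `[< exists t, f t = k >] -> (k <= #|I|)%N.
  by move=> /asboolP[t <-]; exact: max_card.
case: (ex_maxnP exf ubf) => K /asboolP[t ftK] maxK.
exists t; rewrite -/(f t) ftK -lee_fin.
have -> : (p * #|I|%:R)%:E = (\sum_(i : I) p%:E)%E.
  by rewrite sumEFin sumr_const mulr_natr.
apply: (@le_trans _ _ (\sum_(i : I) P (S i))%E); first exact: lee_sum.
have -> : (\sum_(i : I) P (S i) =
    \int[P]_(x in setT) \sum_(i : I) (\1_(S i) x)%:E)%E.
  rewrite ge0_integral_sum //; last first.
    by move=> i; apply/measurable_EFinP; exact: measurable_indic.
  by apply: eq_bigr => i _; rewrite integral_indic ?setIT.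
apply: (@le_trans _ _ (\int[P]_(x in setT) (K%:R)%:E)%E); last first.
  rewrite integral_cst // [X in (_ * X)%E](_ : _ = 1%E) ?mule1 //.
  exact: probability_setT.
apply: ge0_le_integral => //.
- by move=> x _; apply: sume_ge0.
- apply: (@emeasurable_sum _ _ _ _ _ _ (fun i x => (\1_(S i) x)%:E)) => i.
  by apply/measurable_EFinP; exact: measurable_indic.
move=> x _; rewrite sumEFin lee_fin.
have -> : \sum_(i : I) \1_(S i) x = (f x)%:R :> R.
  rewrite /f -sum1dep_card natr_sum [RHS]big_mkcond /=.
  by apply: eq_bigr => i _; rewrite indicE; case: asboolP => Six;
    [rewrite mem_set|rewrite memNset].
by rewrite ler_nat; apply: maxK; apply/asboolP; exists x.
Qed.

(** * Memory states and unit intervals *)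

Fixpoint memory_from (R : realType) (T : Type) (m : nat) (A : @algorithm R T m)
    (t : nat) (x : T) (M : m.-tuple bool) (s : seq R) : m.-tuple bool :=
  if s is r :: s' then memory_from A t.+1 x (update A t x M r) s' else M.

Lemma run_from_cat (R : realType) (T : Type) (m : nat) (A : @algorithm R T m)
    (t : nat) (x : T) (M : m.-tuple bool) (s1 s2 : seq R) :
  run_from A t x M (s1 ++ s2) =
  run_from A (t + size s1) x (memory_from A t x M s1) s2.
Proof.
by elim: s1 t M => [|r s IH] t M /=; rewrite ?addn0 // IH addSnnS.
Qed.

Lemma disjoint_unit_itv (R : realType) (r s : R) :
  r + 1 < s -> unit_itv r `&` unit_itv s = set0.
Proof.
move=> rs; rewrite -subset0 => z []; rewrite /unit_itv /= !in_itv /=.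
by move=> /andP[_ h1] /andP[h2 _]; exfalso; lra.
Qed.

Lemma meet_unit_itv (R : realType) (r s : R) :
  `|r - s| <= 1 -> unit_itv r `&` unit_itv s !=set0.
Proof.
rewrite ler_norml => /andP[h1 h2].
exists (Num.max r s); split; rewrite /unit_itv /= in_itv /=;
  by have [?|?] := leP r s; lra.
Qed.

(** Here [rho < 2] matters: an optimum of size at least 2 forces more than [2 / rho > 1] intervals
    or exactly that many. *)
Lemma approx_solution_gt1 (R : realType) (rho : R) (w : seq R) (A : {fset R})
    (r s : R) :
  0 < rho < 2 -> r \in w -> s \in w -> r + 1 < s ->
  is_approx_solution rho w A -> (1 < #|` A|)%N.
Proof.
move=> /andP[rho0 rho2] rw sw rs [_ [OPT [_ maxOPT] le_A]].
have sol2 : is_solution w [fset r; s]%fset.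
  split; first by move=> z; rewrite !inE => /orP[] /eqP ->.
  move=> i j /=; rewrite !inE => /orP[] /eqP -> /orP[] /eqP -> //.
    by rewrite disjoint_unit_itv // => -[].
  by rewrite setIC disjoint_unit_itv // => -[].
have := maxOPT _ sol2; rewrite cardfs2.
have -> : r != s by apply/eqP => rsE; lra.
rewrite -(ler_nat R) /= => OPT2.
rewrite -(ltr_nat R); apply: lt_le_trans le_A.
by rewrite ltr_pdivlMr //; lra.
Qed.

(** * The hard streams *)

Section IndexStreams.
Variables (R : realType) (N L n : nat).
Hypotheses (nN : (2 * n <= N)%N) (nL : (n < L)%N) (N0 : (0 < N)%N).
Variables (x : {ffun 'I_n -> bool}).

Definition bit_point (j : nat) (b : bool) : R := (2 * j + b)%:R / N%:R.

(** Right of both possible right ends for bit [i], but not of those for later bits; closed intervals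
    that touch do meet. *)
Definition query_point (i : nat) : R := (2 * i + 2 + N)%:R / N%:R.

Definition bit_stream : seq R :=
  [seq bit_point (val j) (x j) | j <- enum 'I_n].


(** The total length becomes [L + i], so exactly the first [i] intervals have expired. *)
Definition query_stream (i : nat) : seq R := nseq (L - n + i) (query_point i).

Lemma window_streams (i : 'I_n) :
  window L (bit_stream ++ query_stream i) =
  drop i bit_stream ++ query_stream i.
Proof.
rewrite /window size_cat size_nseq size_map size_enum_ord.
have -> : (n + (L - n + i) - L = i)%N by lia.
by rewrite drop_cat size_map size_enum_ord ltn_ord.
Qed.

Lemma mem_window_streams (i : 'I_n) (r : R) :
  (r \in window L (bit_stream ++ query_stream i)) =
  (r == query_point i) ||
  [exists j : 'I_n, (i <= j)%N && (r == bit_point j (x j))].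
Proof.
rewrite window_streams mem_cat orbC mem_nseq; congr (_ || _).
  by case: eqP => _; rewrite ?andbT ?andbF //; lia.
rewrite /bit_stream -map_drop.
apply/mapP/existsP => [[j jd ->]|[j /andP[ij /eqP ->]]].
  exists j; rewrite eqxx andbT.
  have : (val j) \in drop i (iota 0 n) by rewrite -val_enum_ord -map_drop map_f.
  by rewrite drop_iota mem_iota => /andP[].
exists j => //.
rewrite -(mem_map val_inj) map_drop val_enum_ord drop_iota mem_iota.
by rewrite add0n ij subnKC ?ltn_ord 1?ltnW.
Qed.

Lemma ler_frac (a b : nat) : (a%:R / N%:R <= b%:R / N%:R :> R) = (a <= b)%N.
Proof. by rewrite ler_pM2r ?invr_gt0 ?ltr0n // ler_nat. Qed.

Lemma eqr_frac (a b : nat) : (a%:R / N%:R == b%:R / N%:R :> R) = (a == b)%N.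
Proof. by rewrite !eq_le !ler_frac -eqn_leq. Qed.

Lemma frac_addr1 (a : nat) : a%:R / N%:R + 1 = (a + N)%:R / N%:R :> R.
Proof. by rewrite natrD mulrDl divff // pnatr_eq0 -lt0n. Qed.

Lemma approx_solution_streams (rho : R) (i : 'I_n) (A : {fset R}) :
  0 < rho < 2 ->
  is_approx_solution rho (window L (bit_stream ++ query_stream i)) A ->
  (bit_point i true \in A) = x i.
Proof.
move=> rho02 apx; have i_lt := ltn_ord i.
have A2 : (1 < #|` A|)%N.
  apply: (@approx_solution_gt1 _ rho _ A (bit_point i (x i)) (query_point i))
    apx => //.
  - rewrite mem_window_streams; apply/orP; right.
    by apply/existsP; exists i; rewrite leqnn /=.
  - by rewrite mem_window_streams eqxx.
  - by rewrite frac_addr1 ltNge ler_frac -ltnNge; case: (x i); lia.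
have [[subA trivA] _] := apx.
have memA r : r \in A -> exists j : 'I_n, (i <= j)%N /\
    (r = bit_point j (x j) \/ r = query_point i).
  move=> /subA; rewrite mem_window_streams.
  move=> /orP[/eqP ->|/existsP[j /andP[ij /eqP ->]]].
    by exists i; split=> //; right.
  by exists j; split=> //; left.
have close r s : r \in A -> s \in A -> `|r - s| <= 1 -> r = s.
  by move=> rA sA rs; apply: trivA => //; exact: meet_unit_itv.
have close_frac (a b : nat) : (a <= b + N)%N -> (b <= a + N)%N ->
    `|a%:R / N%:R - b%:R / N%:R| <= 1 :> R.
  rewrite -!ler_frac -!frac_addr1 ler_norml => h1 h2; apply/andP; split; lra.
have oldest : bit_point i (x i) \in A.
  have [r rA [s sA rs]] : exists2 r, r \in A & exists2 s, s \in A & r != s.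
    have [r rA] : exists r, r \in A by apply/fset0Pn; rewrite -cardfs_gt0; lia.
    exists r => //; have [s] : exists s, s \in (A `\ r)%fset.
      apply/fset0Pn; rewrite -cardfs_gt0; move: A2.
      by rewrite (cardfsD1 r A) rA; lia.
    by rewrite !inE => /andP[sr sA]; exists s => //; rewrite eq_sym.
  (* A later bit interval meets the query interval, so it cannot accompany it in [A]; only [j = i]
     remains. *)
  have key (j : 'I_n) : (i <= j)%N -> bit_point j (x j) \in A ->
      query_point i \in A -> bit_point i (x i) \in A.
    move=> ij jA qA; have [->//|ne_ij] := eqVneq i j.
    have ltij : (i < j)%N by rewrite ltn_neqAle ij andbT.
    have j_lt := ltn_ord j.
    have /eqP : bit_point j (x j) = query_point i.
      by apply: close => //; apply: close_frac; case: (x j); lia.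
    by rewrite eqr_frac; case: (x j); lia.
  have [j [ij [rE|rE]]] := memA r rA;
    have [k [ik [sE|sE]]] := memA s sA; subst r s.
  - exfalso; case/negP: rs; apply/eqP; apply: close => //; apply: close_frac;
      by have := ltn_ord j; have := ltn_ord k; case: (x j); case: (x k); lia.
  - exact: (key j).
  - exact: (key k).
  - by rewrite eqxx in rs.
(* If bit [i] is false, the numerator [2 i + 1] matches no interval of the window. *)
case xi: (x i) oldest => // _.
apply/negbTE/negP => /memA[j [ij [/eqP|/eqP]]]; rewrite eqr_frac; last by lia.
case xj: (x j) => h; last by lia.
have ijE : i = j by apply: val_inj => /=; lia.
by rewrite ijE xj in xi.
Qed.

Lemma streams_fixed_precision (i : 'I_n) (r : R) :
  r \in bit_stream ++ query_stream i -> fixed_precision R N r.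
Proof.
rewrite mem_cat => /orP[/mapP[j _ ->]|/nseqP[-> _]].
  by exists (2 * j + x j)%N => //=; have := ltn_ord j; case: (x j); lia.
by exists (2 * i + 2 + N)%N => //=; have := ltn_ord i; lia.
Qed.

End IndexStreams.

(** * From INDEX to the memory bound *)

Theorem theorem4 (R : realType) (eps : R) (eps_gt0 : 0 < eps)
    (eps_le1 : eps <= 1) :
  exists (c : R) (L0 : nat), 0 < c /\
    forall (L N : nat) (U : set R), (L0 <= L)%N -> (L <= N)%N ->
      fixed_precision R N `<=` U ->
    forall (d : measure_display) (T : measurableType d) (P : probability T R)
      (m : nat) (A : @algorithm R T m),
      computes_approx U L (2 - eps) (2 / 3) P A ->
      c * L%:R <= m%:R.
Proof.
(* [L >= 6] gives [q >= 1], hence [L < 6 q + 6 <= 12 q <= 60 m]. *)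
exists (1 / 60), 6; split; first by lra.
move=> L N U L6 LN precU d T P m A approxA.
pose q := (L %/ 6)%N; pose n := (3 * q)%N.
have qL : (6 * q <= L < 6 * q + 6)%N.
  by rewrite /q; lia.
have nN : (2 * n <= N)%N by lia.
have nL : (n < L)%N by lia.
have N0 : (0 < N)%N by lia.
suff : (q <= 5 * m)%N.
  move=> qm; have : (L <= 60 * m)%N by lia.
  by rewrite -(ler_nat R) natrM; lra.
pose hard (xi : {ffun 'I_n -> bool} * 'I_n) :=
  bit_stream R N xi.1 ++ query_stream R N L n xi.2.
have hardU xi r : r \in hard xi -> U r.
  by move=> rh; apply: precU; exact: (streams_fixed_precision nN nL N0 rh).
pose S xi := [set t | is_approx_solution (2 - eps) (window L (hard xi))
                        (run A (hard xi) t)].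
have [t] : exists t, 2 / 3 * #|{: {ffun 'I_n -> bool} * 'I_n}|%:R <=
    #|[set xi | `[< S xi t >]]%SET|%:R :> R.
  apply: (@exists_outcome_many_events R d T P) => xi;
    by have [] := approxA _ (hardU xi).
rewrite card_prod card_ffun card_bool !card_ord => many.
(* With [t] fixed, the state after [n] intervals is the message, and the decoder restarts from it
   once per query. *)
pose enc (x : {ffun 'I_n -> bool}) :=
  memory_from A 0 t (init A t) (bit_stream R N x).
pose dec M := [ffun i : 'I_n =>
  bit_point R N i true \in run_from A n t M (query_stream R N L n i)].
apply: (@code_size q m enc dec).
have : (2 * q * 2 ^ n <= #|[set xi | `[< S xi t >]]%SET|)%N.
  rewrite -(ler_nat R); apply: le_trans many.
  by rewrite /n !natrM; lra.
move=> /leq_trans; apply.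
rewrite /agreement pair_bigA /= -sum1dep_card big_mkcond /=.
apply: leq_sum => -[x i] _ /=; case: asboolP => // Sxi.
have rho02 : 0 < 2 - eps < 2 by apply/andP; split; lra.
have := approx_solution_streams nN nL N0 rho02 Sxi.
rewrite /run /hard run_from_cat add0n size_map size_enum_ord /= => <-.
by rewrite ffunE eqxx.
Qed.
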